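(* Let $p>0$ and let $n$ be a positive integer. Then $$\sum_{k=0}^{n} (-1)^k \binom{n}{k} B(p+k,\, p+n-k) = \begin{cases} \dfrac{n!\,\Gamma(p)\,\Gamma\!\left(p+\frac{n}{2}\right)}{\Gamma\!\left(\frac{n}{2}+1\right)\Gamma(2p+n)}, & \text{if } n \text{ is even},\\[2ex] 0, & \text{if } n \text{ is odd}.\end{cases}$$
   Context: $\Gamma$ denotes the gamma function and $B(x,y)=\int_0^1 t^{x-1}(1-t)^{y-1}\,dt = \frac{\Gamma(x)\Gamma(y)}{\Gamma(x+y)}$ for $x,y>0$ denotes the beta function. *)

(* Defs.v *)
From mathcomp Require Import all_boot all_order all_algebra.
From mathcomp Require Import all_classical all_reals all_analysis.

Set Implicit Arguments.
Unset Strict Implicit.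
Unset Printing Implicit Defensive.

Import Order.TTheory GRing.Theory Num.Theory.

Local Open Scope classical_set_scope.
Local Open Scope ring_scope.

(* [\int] here is the real-valued Lebesgue integral [Rintegral], which is 0 when
   the integral diverges; both functions below are therefore meaningful only
   for positive arguments. The intervals are open because [0 `^ a = 0] for
   [a != 0], even for [a < 0]. *)

Definition Gamma {R : realType} (x : R) : R :=
  \int[@lebesgue_measure R]_(t in `]0, +oo[) (t `^ (x - 1) * expR (- t)).

(* The library's [beta_fun] only takes natural number arguments. *)
Definition Beta {R : realType} (x y : R) : R :=
  \int[@lebesgue_measure R]_(t in `]0, 1[) (t `^ (x - 1) * (1 - t) `^ (y - 1)).

(* Main.v *)
Require Import Defs.
From mathcomp Require Import all_boot all_order all_algebra.
From mathcomp Require Import all_classical all_reals all_analysis.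
From mathcomp Require Import measurable_realfun exponential_distribution ring lra.

Set Implicit Arguments.
Unset Strict Implicit.
Unset Printing Implicit Defensive.

Import Order.TTheory GRing.Theory Num.Theory.
Import numFieldNormedType.Exports.

Local Open Scope classical_set_scope.
Local Open Scope ring_scope.

(** Write [T n a b] for the sum over [k] of
    [(-1)^k * 'C(n, k) * Beta (a + k) (b + n - k)].
    Since [Beta x y = Beta (x + 1) y + Beta x (y + 1)], Pascal's rule gives
    [T (n + 2) a b = T n a b - 4 * T n (a + 1) (b + 1)].  Once the beta function
    is known to be [Gamma x * Gamma y / Gamma (x + y)], the even case follows by
    induction on [n] for all [p] simultaneously, and the odd case from
    [T n a b = (-1)^n * T n b a].

    The quotient formula comes from convolving the two integrands (extended by
    zero to the whole line) and Tonelli's theorem, using only the behaviour of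
    the Lebesgue measure under affine maps.  With [y = 1] and
    [Beta x 1 = 1 / x] it also yields [Gamma (x + 1) = x * Gamma x], from which
    the finiteness of [Gamma] is deduced by comparison with integer arguments. *)

(** * Affine substitution in Lebesgue integrals *)

Section gamma_beta.
Context {R : realType}.
Notation mu := (@lebesgue_measure R).
Implicit Types (a b s t u x y : R) (f : R -> \bar R).

(** [a] times the pushforward of [mu] under [t |-> a * t + b] agrees with [mu] on half-open
    intervals, hence everywhere. *)
Lemma ge0_integral_affine a b f : 0 < a ->
  measurable_fun [set: R] f -> (forall t, 0 <= f t)%E ->
  (\int[mu]_t f t = a%:E * \int[mu]_t f (a * t + b)%R)%E.
Proof.
move=> a0 mf f0.
pose phi : measurableTypeR R -> measurableTypeR R := fun t => a * t + b.
have mphi : measurable_fun setT phi.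
  by apply: measurable_funD => //; exact: measurable_funM.
pose nu : {measure set (measurableTypeR R) -> \bar R} :=
  measure_function_pushforward__canonical__measure_function_Measure mu mphi.
pose k : {nonneg R} := NngNum (ltW a0).
transitivity (\int[mscale k nu]_t f t)%E.
  apply: eq_measure_integral => A mA _.
  apply: lebesgue_measure_unique => // _ [[c d]] _ <-.
  rewrite /= /mscale/= /pushforward.
  rewrite (_ : phi @^-1` _ = `](c - b) / a, (d - b) / a]%classic); last first.
    apply/seteqP; split => t /=; rewrite !in_itv/= /phi ltr_pdivrMr// ler_pdivlMr//;
    by rewrite ltrBlDr lerBrDr (mulrC t).
  rewrite !lebesgue_measure_itv/= !lte_fin ltr_pM2r ?invr_gt0// ltrD2r.
  case: ifPn => _; last by rewrite mule0.
  by rewrite -!EFinD -EFinM; congr EFin; field; rewrite gt_eqF.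
by rewrite ge0_integral_mscale// (ge0_integral_pushforward mphi).
Qed.

(** * Gamma and beta integrands on the whole line *)

(** The indicator removes the default values of the power at [t <= 0]. *)
Definition pospow x t : R := t `^ (x - 1) * \1_(`]0, +oo[ : set R) t.

Lemma pospow_ge0 x t : 0 <= pospow x t.
Proof. by rewrite mulr_ge0 ?powR_ge0. Qed.

Lemma pospow_gt0E x t : 0 < t -> pospow x t = t `^ (x - 1).
Proof. by move=> t0; rewrite /pospow indicE mem_set ?mulr1//= in_itv/= t0. Qed.

Lemma pospow_le0E x t : t <= 0 -> pospow x t = 0.
Proof.
move=> t0; rewrite /pospow indicE memNset ?mulr0//= in_itv/= andbT.
by apply/negP; rewrite -leNgt.
Qed.

Lemma measurable_pospow x : measurable_fun setT (pospow x).
Proof. by apply: measurable_funM => //; exact: measurable_powR. Qed.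

(* Values in [\bar R]: the product formula [eGammaM] is proved before, and used
   for, the convergence of these integrals. *)
Definition eGamma x : \bar R := (\int[mu]_t (pospow x t * expR (- t))%:E)%E.
Definition eBeta x y : \bar R := (\int[mu]_t (pospow x t * pospow y (1 - t))%:E)%E.

Lemma integral_indicE (A : set R) (f g : R -> R) :
  (forall t, A t -> f t = g t) -> (forall t, ~ A t -> g t = 0) ->
  (\int[mu]_(t in A) (f t)%:E = \int[mu]_t (g t)%:E)%E.
Proof.
move=> fg g0; rewrite integral_mkcond; apply: eq_integral => t _.
rewrite patchE; case: ifPn => [/set_mem/fg -> //|].
by move=> /negP At; rewrite g0// => /mem_set.
Qed.

Lemma eGammaE x :
  eGamma x = (\int[mu]_(t in `]0%R, +oo[) (t `^ (x - 1) * expR (- t))%:E)%E.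
Proof.
apply/esym/integral_indicE => t /=; rewrite in_itv/= andbT => t0.
  by rewrite pospow_gt0E.
by rewrite pospow_le0E ?mul0r// leNgt; apply/negP.
Qed.

Lemma eBetaE x y : eBeta x y =
  (\int[mu]_(t in `]0%R, 1%R[) (t `^ (x - 1) * (1 - t) `^ (y - 1))%:E)%E.
Proof.
apply/esym/integral_indicE => t /=; rewrite in_itv/=.
  by move=> /andP[t0 t1]; rewrite !pospow_gt0E// subr_gt0.
move=> /negP; rewrite negb_and -!leNgt => /orP[t0|t1].
  by rewrite pospow_le0E ?mul0r.
by rewrite (pospow_le0E y) ?mulr0// subr_le0.
Qed.

Lemma Gamma_fine x : Gamma x = fine (eGamma x).
Proof. by rewrite eGammaE. Qed.

Lemma Beta_fine x y : Beta x y = fine (eBeta x y).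
Proof. by rewrite eBetaE. Qed.

Lemma measurable_Gamma_integrand x :
  measurable_fun [set: R] (fun t => (pospow x t * expR (- t))%:E).
Proof.
apply/measurable_EFinP.
apply: measurable_funM; first exact: measurable_pospow.
by apply: measurableT_comp => //; exact: measurable_funN.
Qed.

Lemma eGamma_ge0 x : (0 <= eGamma x)%E.
Proof. by apply: integral_ge0 => t _; rewrite lee_fin mulr_ge0 ?pospow_ge0 ?expR_ge0. Qed.

Lemma eBeta_ge0 x y : (0 <= eBeta x y)%E.
Proof. by apply: integral_ge0 => t _; rewrite lee_fin mulr_ge0 ?pospow_ge0. Qed.

(** * Convolution of powers and the product formula *)

Lemma measurable_pospow_conv x y u :
  measurable_fun [set: R] (fun s => (pospow x s * pospow y (u - s))%:E).
Proof.
apply/measurable_EFinP.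
apply: measurable_funM; first exact: measurable_pospow.
apply: measurableT_comp; first exact: measurable_pospow.
exact: measurable_funB.
Qed.

(** For [u > 0], substituting [s = u * t] pulls out all powers of [u]. For [u <= 0] both sides
    vanish, as [s] and [u - s] are never both positive. *)
Lemma integral_pospow_conv x y u :
  (\int[mu]_s (pospow x s * pospow y (u - s))%:E =
   (pospow (x + y) u)%:E * eBeta x y)%E.
Proof.
have [u0|u0] := leP u 0.
  rewrite (pospow_le0E _ u0) mul0e; apply: integral0_eq => s _; rewrite -[0%E]/(0%R%:E); congr EFin.
  have [s0|s0] := leP s 0; first by rewrite pospow_le0E ?mul0r.
  by rewrite (pospow_le0E y) ?mulr0// subr_le0 (le_trans u0)// ltW.
rewrite (ge0_integral_affine 0 u0); last 2 first.
- exact: measurable_pospow_conv.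
- by move=> t; rewrite lee_fin mulr_ge0 ?pospow_ge0.
have scal z t : pospow z (u * t) = u `^ (z - 1) * pospow z t.
  have [t0|t0] := leP t 0.
    by rewrite !pospow_le0E ?mulr0// pmulr_rle0.
  by rewrite !pospow_gt0E ?mulr_gt0// powRM ?ltW.
transitivity (u%:E * \int[mu]_t ((u `^ (x - 1) * u `^ (y - 1))%:E *
    (pospow x t * pospow y (1 - t))%:E))%E.
  congr (_ * _)%E; apply: eq_integral => t _; rewrite -EFinM; congr EFin.
  rewrite addr0 (_ : u - u * t = u * (1 - t)); last by ring.
  by rewrite !scal; ring.
rewrite ge0_integralZl//; last 3 first.
- exact: measurable_pospow_conv.
- by move=> t _; rewrite lee_fin mulr_ge0 ?pospow_ge0.
- by rewrite lee_fin mulr_ge0 ?powR_ge0.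
rewrite muleA -EFinM; congr (_%:E * _)%E.
rewrite pospow_gt0E//.
rewrite -{1}(powRr1 (ltW u0)) -!powRD ?(gt_eqF u0) ?implybT//.
by congr (_ `^ _); ring.
Qed.

(** Both sides are iterated integrals of [h]: integrating over [u] first gives the product, over [s]
    first the convolution. *)
Lemma eGammaM x y : (eGamma x * eGamma y = eBeta x y * eGamma (x + y))%E.
Proof.
pose h (z : measurableTypeR R * measurableTypeR R) :=
  ((pospow x z.1 * pospow y (z.2 - z.1)) * expR (- z.2))%:E.
have mh : measurable_fun setT h.
  apply/measurable_EFinP; apply: measurable_funM.
    apply: measurable_funM; first exact: measurableT_comp (measurable_pospow x) _.
    apply: measurableT_comp (measurable_pospow y) _.
    exact: measurable_funB.
  apply: measurableT_comp => //; exact: measurable_funN.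
have h0 z : (0 <= h z)%E.
  by rewrite lee_fin mulr_ge0 ?expR_ge0 ?(mulr_ge0 (pospow_ge0 _ _))// pospow_ge0.
transitivity (\int[mu]_s \int[mu]_u h (s, u))%E.
  rewrite /eGamma -ge0_integralZr//; last 3 first.
  - exact: measurable_Gamma_integrand.
  - by move=> t _; rewrite lee_fin mulr_ge0 ?pospow_ge0 ?expR_ge0.
  - exact: eGamma_ge0.
  apply: eq_integral => s _.
  rewrite -ge0_integralZl//; last 3 first.
  - exact: measurable_Gamma_integrand.
  - by move=> t _; rewrite lee_fin mulr_ge0 ?pospow_ge0 ?expR_ge0.
  - by rewrite lee_fin mulr_ge0 ?pospow_ge0 ?expR_ge0.
  (* Translation [u = t + s] in the inner integral. *)
  rewrite [RHS](@ge0_integral_affine 1 s)//; last first.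
    by apply: measurableT_comp mh _; exact: measurable_pair1.
  rewrite mul1e; apply: eq_integral => t _; rewrite -EFinM/= /h/=; congr EFin.
  rewrite mul1r addrK opprD expRD; ring.
rewrite (fubini_tonelli h mh h0).
rewrite /eGamma -ge0_integralZl//; last 3 first.
- exact: measurable_Gamma_integrand.
- by move=> t _; rewrite lee_fin mulr_ge0 ?pospow_ge0 ?expR_ge0.
- exact: eBeta_ge0.
apply: eq_integral => u _; rewrite /h/=.
under eq_integral do rewrite EFinM.
rewrite ge0_integralZr//; last 2 first.
- exact: measurable_pospow_conv.
- by move=> t _; rewrite lee_fin mulr_ge0 ?pospow_ge0.
by rewrite integral_pospow_conv [in RHS]EFinM muleA (muleC (eBeta x y)).
Qed.

(** * Special values and the functional equation *)

(** The integrand is the exponential density of rate 1, of total mass 1. *)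
Lemma eGamma1 : eGamma 1 = 1%E.
Proof.
rewrite eGammaE -(@integral_exponential_pdf R 1)//.
rewrite subrr integral_itv_obnd_cbnd; last first.
  apply/measurable_EFinP; apply: measurable_funTS.
  apply: measurable_funM; first exact: measurable_powR.
  by apply: measurableT_comp => //; exact: measurable_funN.
apply: integral_indicE => t /=; rewrite in_itv/= andbT => t0.
  by rewrite exponential_pdfE// powRr0 mulN1r.
by rewrite lt0_exponential_pdf// ltNge; apply/negP.
Qed.

Lemma integral_powR_itv x a : 0 < x -> 0 < a < 1 ->
  (\int[mu]_(t in `[a, 1%R]) (t `^ (x - 1))%:E = (x^-1 - a `^ x / x)%:E)%E.
Proof.
move=> x0 /andP[a0 a1].
have cpow z t : 0 < t -> {for t, continuous (fun t => t `^ z)}.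
  move=> t0; apply: differentiable_continuous; apply/derivable1_diffP.
  by apply: derivable_powR; rewrite in_itv/= t0.
have gta t : t \in `[a, 1] -> 0 < t.
  by rewrite in_itv/= => /andP[at_ _]; exact: lt_le_trans at_.
rewrite (@continuous_FTC2 _ _ (fun t => t `^ x / x))//.
- by rewrite powR1 div1r.
- apply: continuous_in_subspaceT => t /set_mem/= /gta; exact: cpow.
- split => [t| |].
  + rewrite in_itv/= => /andP[at_ _]; apply: derivableM => //.
    by apply: derivable_powR; rewrite in_itv/= (lt_trans a0).
  + apply: cvg_at_right_filter; apply: cvgM; last exact: cvg_cst.
    exact: cpow.
  + apply: cvg_at_left_filter; apply: cvgM; last exact: cvg_cst.
    exact: cpow.
- move=> t; rewrite in_itv/= => /andP[at_ _].
  have t0 := lt_trans a0 at_.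
  rewrite derive1E deriveM//; last first.
    by apply: derivable_powR; rewrite in_itv/= t0.
  rewrite derive_cst scaler0 add0r.
  have [_ ->] := is_derive1_powR x t0.
  by rewrite -[LHS]/(_ * _) mulrA mulVf ?mul1r// gt_eqF.
Qed.

Lemma eBeta_1r x : 0 < x -> eBeta x 1 = (x^-1)%:E.
Proof.
move=> x0; rewrite eBetaE.
under eq_integral do rewrite subrr powRr0 mulr1.
have mpow (A : set R) : measurable_fun A (fun t => (t `^ (x - 1))%:E).
  by apply/measurable_EFinP; apply: measurable_funTS; exact: measurable_powR.
rewrite integral_itv_bndo_bndc//.
(* Monotone convergence along [F], avoiding the possible singularity at 0; [n.+2] keeps the left
   endpoint strictly below 1. *)
pose F (n : nat) : set R := `[n.+2%:R^-1, 1%R]%classic.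
have -> : `]0%R, 1%R]%classic = \bigcup_n F n.
  apply/seteqP; split => t /=.
    rewrite in_itv/= => /andP[t0 t1].
    exists (Num.truncn t^-1) => //; rewrite /F/= in_itv/= t1 andbT.
    rewrite -[leRHS]invrK lef_pV2 ?posrE ?invr_gt0//.
    by rewrite ltW// (lt_le_trans (truncnS_gt _))// ler_nat.
  move=> [n _]; rewrite /F/= !in_itv/= => /andP[nt ->]; rewrite andbT.
  by rewrite (lt_le_trans _ nt)// invr_gt0.
have ndF : nondecreasing_seq F.
  move=> m n mn; rewrite subsetEset => t; rewrite /F/= !in_itv/= => /andP[+ ->].
  by rewrite andbT; apply: le_trans; rewrite lef_pV2 ?posrE// ler_nat.
have := @ge0_nondecreasing_set_cvg_integral _ (measurableTypeR R) R F
  (fun t => (t `^ (x - 1))%:E) lebesgue_measure ndF (fun=> measurable_itv _) (fun=> mpow _)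
  (fun _ t _ => powR_ge0 t (x - 1)).
move/cvg_lim => <-//; apply: cvg_lim => //.
have FE n : (\int[mu]_(t in F n) (t `^ (x - 1))%:E =
    (x^-1 - n.+2%:R^-1 `^ x / x)%:E)%E.
  by rewrite integral_powR_itv// invr_gt0 ltr0n invf_lt1// ltr1n.
under eq_fun do rewrite FE.
apply: cvg_EFin; first by near=> n.
rewrite -[X in _ --> X]subr0 -(mul0r x^-1).
apply: cvgB; first exact: cvg_cst.
apply: cvgM; last exact: cvg_cst.
have /cvg_at_rightP := powR_cvg0 x0; apply; split => [n|].
  by rewrite invr_gt0.
have := @cvg_harmonic R; rewrite -cvg_shiftS; exact.
Unshelve. all: by end_near. Qed.

Lemma eGammaS x : 0 < x -> eGamma (x + 1) = (x%:E * eGamma x)%E.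
Proof.
move=> x0; rewrite -[eGamma x]mule1 -eGamma1 eGammaM eBeta_1r// muleA -EFinM.
by rewrite divff ?mul1e// gt_eqF.
Qed.

(** * Finiteness and positivity of the gamma function *)

Lemma eGamma_nat_fin n : eGamma n.+1%:R \is a fin_num.
Proof.
elim: n => [|n IH]; first by rewrite eGamma1.
by rewrite -natr1 eGammaS// fin_numM.
Qed.

Lemma eGamma_fin x : 0 < x -> eGamma x \is a fin_num.
Proof.
move=> x0.
(* The shift keeps the lower integer argument [n + 1] positive even if [x < 1]. The bound is
   [t^x <= t^n + t^(n+1)]: the first term dominates for [t <= 1], the second for [t > 1]. *)
suff : eGamma (x + 1) \is a fin_num.
  by rewrite eGammaS//; case: (eGamma x) => //; rewrite ?gt0_muley ?gt0_muleNy.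
pose n := Num.truncn x.
have /andP[nx xn] : n%:R <= x < n.+1%:R by rewrite truncn_itv// ltW.
rewrite ge0_fin_numE ?eGamma_ge0//.
apply: (@le_lt_trans _ _ (eGamma n.+1%:R + eGamma n.+2%:R)%E); last first.
  by rewrite lte_add_pinfty// -ge0_fin_numE ?eGamma_ge0 ?eGamma_nat_fin.
rewrite /eGamma -ge0_integralD//; last 4 first.
- by move=> t _; rewrite lee_fin mulr_ge0 ?pospow_ge0 ?expR_ge0.
- exact: measurable_Gamma_integrand.
- by move=> t _; rewrite lee_fin mulr_ge0 ?pospow_ge0 ?expR_ge0.
- exact: measurable_Gamma_integrand.
apply: ge0_le_integral => //.
- by move=> t _; rewrite lee_fin mulr_ge0 ?pospow_ge0 ?expR_ge0.
- exact: measurable_Gamma_integrand.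
- by apply: emeasurable_funD; exact: measurable_Gamma_integrand.
move=> t _; rewrite -EFinD lee_fin -mulrDl ler_wpM2r ?expR_ge0//.
have [t0|t0] := leP t 0; first by rewrite !pospow_le0E// addr0.
rewrite !pospow_gt0E// addrK -!natr1 !addrK.
have [t1|t1] := leP t 1.
  by rewrite (@le_trans _ _ (t `^ n%:R)) ?lerDl ?powR_ge0// ger_powR// t0.
rewrite (@le_trans _ _ (t `^ (n%:R + 1))) ?lerDr ?powR_ge0//.
by rewrite ler_powR ?ltW// natr1.
Qed.

Lemma eGamma_gt0 x : 0 < x -> (0 < eGamma x)%E.
Proof.
move=> x0.
suff : (0 < eGamma (x + 1))%E.
  rewrite eGammaS// !lt_def eGamma_ge0 andbT => /andP[+ _].
  by apply: contra => /eqP ->; rewrite mule0.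
(* On [[1, 2]] the integrand [t^x * exp(-t)] is at least [exp(-2)]. *)
apply: (@lt_le_trans _ _ (\int[mu]_(t in `[1%R, 2%R]) (expR (- 2))%:E)%E).
  rewrite integral_cst//= lebesgue_measure_itv/= lte_fin ltr1n -EFinB -EFinM.
  by rewrite lte_fin mulr_gt0 ?expR_gt0// subr_gt0 ltr1n.
rewrite eGammaE addrK.
have mG : measurable_fun [set: R] (fun t => (t `^ x * expR (- t))%:E).
  apply/measurable_EFinP; apply: measurable_funM; first exact: measurable_powR.
  by apply: measurableT_comp => //; exact: measurable_funN.
apply: (@le_trans _ _ (\int[mu]_(t in `[1%R, 2%R]) (t `^ x * expR (- t))%:E)%E).
  apply: ge0_le_integral => //.
  - exact: measurable_funTS.
  move=> t /=; rewrite in_itv/= => /andP[t1 t2].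
  rewrite lee_fin -[leLHS]mul1r ler_pM ?expR_ge0 ?ler_expR ?lerN2//.
  by rewrite -(powRr0 t) ler_powR// ltW.
apply: ge0_subset_integral => //.
- exact: measurable_funTS.
- by move=> t _; rewrite lee_fin mulr_ge0 ?powR_ge0 ?expR_ge0.
move=> t /=; rewrite !in_itv/= andbT => /andP[t1 _].
exact: lt_le_trans t1.
Qed.

Lemma Gamma_gt0 x : 0 < x -> 0 < Gamma x.
Proof.
move=> x0; rewrite Gamma_fine fine_gt0// eGamma_gt0//=.
by rewrite -ge0_fin_numE ?eGamma_ge0// eGamma_fin.
Qed.

Lemma GammaS x : 0 < x -> Gamma (x + 1) = x * Gamma x.
Proof. by move=> x0; rewrite !Gamma_fine eGammaS// fineM// eGamma_fin. Qed.

Lemma Gamma1 : Gamma (1 : R) = 1.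
Proof. by rewrite Gamma_fine eGamma1. Qed.

Lemma BetaE x y : 0 < x -> 0 < y ->
  Beta x y = Gamma x * Gamma y / Gamma (x + y).
Proof.
move=> x0 y0; have xy0 := addr_gt0 x0 y0.
have G0 := Gamma_gt0 xy0.
apply: (mulIf (lt0r_neq0 G0)); rewrite (divfK (lt0r_neq0 G0)).
(* Its product with the positive [eGamma (x + y)] is finite by [eGammaM]. *)
have Bfin : eBeta x y \is a fin_num.
  have : (eBeta x y * eGamma (x + y))%E \is a fin_num.
    by rewrite -eGammaM fin_numM ?eGamma_fin.
  by case: (eBeta x y) => //=; rewrite ?gt0_mulye ?gt0_mulNye ?eGamma_gt0.
by rewrite Beta_fine !Gamma_fine -!fineM ?eGamma_fin// eGammaM.
Qed.

End gamma_beta.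

(** * Alternating binomial sums of a two-variable function *)

Section alternating_binomial_sum.
Context {R : comPzRingType}.
Implicit Types (f : R -> R -> R) (a b : R) (n : nat).

(** [a] and [b] are independent because the recurrence shifts them separately. *)
Definition altbinsum f n a b : R :=
  \sum_(0 <= k < n.+1) (-1) ^+ k * 'C(n, k)%:R * f (a + k%:R) (b + n%:R - k%:R).

Lemma altbinsum0 f a b : altbinsum f 0 a b = f a b.
Proof. by rewrite /altbinsum big_nat1 bin0 expr0 !mul1r addr0 subr0 addr0. Qed.

Lemma altbinsumS f n a b :
  altbinsum f n.+1 a b = altbinsum f n a (b + 1) - altbinsum f n (a + 1) b.
Proof.
rewrite /altbinsum big_nat_recl// !bin0.
under eq_bigr do rewrite binS natrD mulrDr mulrDl.
rewrite big_split/= addrA; congr (_ + _).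
  (* The [k = 0] term joins the ['C(n, k.+1)] half of Pascal's rule; the top term vanishes since
     ['C(n, n.+1) = 0]. *)
  transitivity (\sum_(0 <= k < n.+2)
      (-1) ^+ k * 'C(n, k)%:R * f (a + k%:R) (b + n.+1%:R - k%:R)).
    by rewrite [RHS]big_nat_recl// bin0.
  rewrite big_nat_recr//= bin_small// mulr0 mul0r addr0.
  by apply: eq_bigr => k _; rewrite -natr1 [n%:R + 1]addrC (addrA b).
rewrite -sumrN; apply: eq_bigr => k _.
rewrite exprS mulN1r !mulNr; congr (- (_ * f _ _)); rewrite -!natr1; ring.
Qed.

End alternating_binomial_sum.

(** * Recurrences and closed form for gamma quotients *)

(* [B] and [G] stand for the beta and gamma functions; only the functional
   equation of [G] and its positivity matter here. *)
Section gamma_quotient_sum.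
Context {R : realFieldType}.
Variable G : R -> R.
Hypothesis G_gt0 : forall x, 0 < x -> 0 < G x.
Hypothesis GS : forall x, 0 < x -> G (x + 1) = x * G x.
Variable B : R -> R -> R.
Hypothesis BE : forall x y, 0 < x -> 0 < y -> B x y = G x * G y / G (x + y).
Implicit Types (a b x y p : R) (n m : nat).

(** By [GS] the two terms are [x / (x + y)] and [y / (x + y)] times [B x y]. *)
Lemma gamma_quotient_split x y : 0 < x -> 0 < y ->
  B x y = B (x + 1) y + B x (y + 1).
Proof.
move=> x0 y0; rewrite !BE ?addr_gt0//.
rewrite (addrAC x 1 y) (addrA x y 1) !GS ?addr_gt0//.
have G0 : G (x + y) != 0 by rewrite gt_eqF// G_gt0 ?addr_gt0.
by field; rewrite G0 gt_eqF ?addr_gt0.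
Qed.

Lemma gamma_quotient_sym x y : 0 < x -> 0 < y -> B x y = B y x.
Proof. by move=> x0 y0; rewrite !BE// (addrC y) (mulrC (G y)). Qed.

Lemma altbinsum_split n a b : 0 < a -> 0 < b ->
  altbinsum B n a b = altbinsum B n (a + 1) b + altbinsum B n a (b + 1).
Proof.
elim: n a b => [|n IH] a b a0 b0.
  by rewrite !altbinsum0 gamma_quotient_split.
by rewrite !altbinsumS (IH a (b + 1)) ?(IH (a + 1) b) ?addr_gt0//; ring.
Qed.

(** Exchanging [a] and [b] swaps the two terms of [altbinsumS], so each step in [n] contributes one
    sign. *)
Lemma altbinsum_sym n a b : 0 < a -> 0 < b ->
  altbinsum B n a b = (-1) ^+ n * altbinsum B n b a.
Proof.
elim: n a b => [|n IH] a b a0 b0.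
  by rewrite !altbinsum0 expr0 mul1r gamma_quotient_sym.
by rewrite !altbinsumS (IH a) ?(IH _ b) ?addr_gt0// exprS; ring.
Qed.

(* For the beta function the sum is the integral of
   [t ^ (a-1) * (1-t) ^ (b-1) * (1-2t) ^ n], and [(1-2t)^2 = 1 - 4t(1-t)]. *)
Lemma altbinsumSS n a b : 0 < a -> 0 < b ->
  altbinsum B n.+2 a b =
  altbinsum B n a b - 4 * altbinsum B n (a + 1) (b + 1).
Proof.
(* Shifts by [(0,2)], [(1,1)], [(2,0)] have weights 1, -2, 1 on the left and 1, 2, 1 in the expanded
   sum at [(a, b)]; hence the 4. *)
move=> a0 b0; rewrite !altbinsumS (altbinsum_split n a0 b0).
rewrite (altbinsum_split n (addr_gt0 a0 ltr01) b0).
by rewrite (altbinsum_split n a0 (addr_gt0 b0 ltr01)); ring.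
Qed.

Lemma altbinsum_odd n p : 0 < p -> odd n -> altbinsum B n p p = 0.
Proof.
move=> p0 on; have := altbinsum_sym n p0 p0.
by rewrite -signr_odd on expr1 mulN1r => h; lra.
Qed.

Lemma altbinsum_double m p : 0 < p ->
  altbinsum B m.*2 p p =
  m.*2`!%:R * G p * G (p + m%:R) / (m`!%:R * G (2 * p + m.*2%:R)).
Proof.
elim: m p => [|m IH] p p0.
  by rewrite altbinsum0 BE// !fact0 !addr0 !mul1r (mulr_natl p 2).
have p10 : 0 < p + 1 by rewrite addr_gt0.
have pm0 : 0 < p + m%:R by rewrite ltr_wpDr.
rewrite doubleS altbinsumSS// !IH//.
rewrite !factS !natrM -(natr1 m.*2.+1) -(natr1 m.*2) -(natr1 m).
rewrite (addrA p) (addrAC p 1).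
have -> : 2 * (p + 1) + m.*2%:R = 2 * p + m.*2%:R + 1 + 1 by ring.
rewrite !(addrA (2 * p)) -muln2 natrM.
have q0 : 0 < 2 * p + m%:R * 2 by rewrite ltr_wpDr ?mulr_gt0 ?mulr_ge0.
have q10 : 0 < 2 * p + m%:R * 2 + 1 by rewrite addr_gt0.
(* Only [G p], [G (p + m)] and [G (2p + 2m)] remain; made opaque, they leave a rational identity. *)
rewrite !GS//.
have G0 : G (2 * p + m%:R * 2) != 0 by rewrite gt_eqF ?G_gt0.
have mf0 : m`!%:R != 0 :> R by rewrite pnatr_eq0 -lt0n fact_gt0.
have m10 : m%:R + 1 != 0 :> R by rewrite natr1 pnatr_eq0.
move/lt0r_neq0 in q0; move/lt0r_neq0 in q10.
move: G0 mf0 m10 q10 q0 {IH pm0}.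
move: (G _) (G p) (G _) => G1 G2 G3.
move: (m`!%:R) ((m * 2)`!%:R) (m%:R) => F1 F2 M.
move=> G30 F10 M10 q10 q0.
by field; rewrite G30 F10 M10 q10 q0.
Qed.

(** Identifies the factorial of [m] in [altbinsum_double] with [Gamma (n / 2 + 1)] of the
    theorem. *)
Lemma gamma_natS n : G 1 = 1 -> G (n%:R + 1) = n`!%:R.
Proof.
move=> G1; elim: n => [|n IH]; first by rewrite add0r G1.
by rewrite GS// -natr1 IH factS natrM -natr1.
Qed.

End gamma_quotient_sum.

Theorem theorem2p4 (R : realType) (p : R) (n : nat) (hp : 0 < p) (hn : (0 < n)%N) :
  \sum_(0 <= k < n.+1)
    (-1) ^+ k * 'C(n, k)%:R * Beta (p + k%:R) (p + n%:R - k%:R) =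
  if ~~ odd n then
    n`!%:R * Gamma p * Gamma (p + n%:R / 2)
      / (Gamma (n%:R / 2 + 1) * Gamma (2 * p + n%:R))
  else 0.
Proof.
rewrite -[LHS]/(altbinsum Beta n p p).
have hG := @Gamma_gt0 R; have hS := @GammaS R; have hB := @BetaE R.
case: ifPn => [en|/negbNE]; last exact: (altbinsum_odd hB).
rewrite -(even_halfK en) (altbinsum_double hG hS hB)//.
rewrite -[in _ / 2]muln2 natrM mulfK//.
by rewrite (gamma_natS hS _ (@Gamma1 R)).
Qed.
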